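(* Let $r=r(n)$, $s=s(n)$ satisfy $n\gg r(n)\gg s(n)$. Then $$q^*(G(n,r,s))\to 0,\quad n\to\infty.$$
   Context: For integers $n,r,s$, the Johnson graph $G(n,r,s)$ has as vertices all vectors $v\in\{0,1\}^n$ with exactly $r$ ones; two vertices are joined by an edge if and only if their inner product equals $s$. Modularity: for a graph $G$ with $e(G)$ edges and a partition $\mathcal{A}$ of its vertex set, $q(\mathcal{A})=\sum_{A\in\mathcal{A}}\frac{e(A)}{e(G)}-\sum_{A\in\mathcal{A}}\frac{(\sum_{v\in A}\deg(v))^2}{4e(G)^2}$, where $e(A)$ is the number of edges of $G$ with both endpoints in $A$. The modularity of $G$ is $q^*(G)=\max_{\mathcal{A}}q(\mathcal{A})$, over all partitions of the vertex set. $f(n)\gg g(n)$ means $f(n)/g(n)\to\infty$ as $n\to\infty$. *)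

(* Defs.v *)
From HB Require Import structures.
From mathcomp Require Import all_boot all_order all_algebra.
From mathcomp Require Import all_classical all_reals all_analysis.

Set Implicit Arguments.
Unset Strict Implicit.
Unset Printing Implicit Defensive.

Import Order.TTheory GRing.Theory Num.Theory.
Import numFieldNormedType.Exports.

Record sgraph := SGraph {
  vertex :> finType;
  adj : rel vertex;
  adj_sym : symmetric adj;
  adj_irr : irreflexive adj }.

Section GraphModularity.
Variable G : sgraph.

Definition edges : {set {set G}} :=
  [set [set p.1; p.2] | p : G * G & adj p.1 p.2]%SET.

Definition edges_in (A : {set G}) : nat := #|[set E in edges | E \subset A]%SET|.

Definition deg (v : G) : nat := #|[set w | adj v w]%SET|.

Local Open Scope ring_scope.

Definition partition_modularity (R : realType) (P : {set {set G}}) : R :=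
  \sum_(A in P) (edges_in A)%:R / #|edges|%:R
  - \sum_(A in P) (\sum_(v in A) deg v)%N%:R ^+ 2 / (4 * #|edges|%:R ^+ 2).

Definition singletons : {set {set G}} := [set [set v] | v in [set: G]]%SET.

Lemma singletons_partition : finset.partition singletons [set: G]%SET.
Proof.
apply/and3P; split.
- apply/eqP/finset.setP => v; rewrite finset.in_setT; apply/finset.bigcupP.
  by exists [set v]%SET; [apply: imset_f | rewrite finset.in_set1].
- apply/finset.trivIsetP => _ _ /imsetP[v _ ->] /imsetP[w _ ->] vw.
  by rewrite disjoints1 finset.in_set1; apply: contra vw => /eqP ->.
- apply/imsetP => -[v _ /finset.setP/(_ v)].
  by rewrite finset.in_set0 finset.in_set1 eqxx.
Qed.

(* The initial value is attained by a partition, so this is the maximum over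
   all partitions.  When there is no edge every quotient is x / 0 = 0. *)
Definition modularity (R : realType) : R :=
  \big[Num.max/partition_modularity R singletons]_(P : {set {set G}}
       | finset.partition P [set: G]%SET) partition_modularity R P.

End GraphModularity.

Section Johnson.
Variables n r s : nat.

Definition inner (v w : {ffun 'I_n -> bool}) : nat := \sum_(i < n) v i * w i.

Definition johnson_vertex :=
  {v : {ffun 'I_n -> bool} | \sum_(i < n) v i == r}.

(* v != w only matters when r = s, where it excludes loops. *)
Definition johnson_adj : rel johnson_vertex :=
  fun v w => (v != w) && (inner (val v) (val w) == s).

Lemma johnson_adj_sym : symmetric johnson_adj.
Proof.
move=> v w; rewrite /johnson_adj eq_sym; congr (_ && (_ == _)).
by apply: eq_bigr => i _; rewrite mulnC.
Qed.

Lemma johnson_adj_irr : irreflexive johnson_adj.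
Proof. by move=> v; rewrite /johnson_adj eqxx. Qed.

Definition johnson : sgraph := SGraph johnson_adj_sym johnson_adj_irr.

End Johnson.

(* The quotient is taken in the extended reals, where x / 0 = +oo for x > 0 and
   0 / x = 0 for every x (including 0); thus f >> 0 means that f is eventually
   positive. *)
Definition much_greater (R : realType) (f g : nat -> nat) : Prop :=
  ((((f n)%:R%:E / (g n)%:R%:E : \bar R)%E @[n --> \oo]) --> (+oo : \bar R)%E)%classic.

(* Main.v *)
Require Import Defs.
From mathcomp Require Import all_boot all_order all_algebra.
From mathcomp Require Import perm.
From mathcomp Require Import all_classical all_reals all_analysis.
From mathcomp Require Import ring lra.
Import Order.TTheory GRing.Theory Num.Theory.
Import numFieldNormedType.Exports.
Local Open Scope ring_scope.
Local Open Scope classical_set_scope.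

(* Couple the neighbours of a vertex v with those of its image under a
   transposition (a b), a in v, b not in v, by applying (a b) to them.  A random
   neighbour w of v is moved only when it contains a or b, which has
   probability at most kappa = s/r + (r-s)/(n-r).  Hence the random walk
   contracts Lipschitz functions for the transposition metric by kappa.
   Iterating it and comparing with Cauchy-Schwarz bounds the Rayleigh quotient
   of every mean-zero function by kappa, and for a regular graph such a bound
   on the indicators of the parts (made mean-zero) gives modularity at most
   kappa, which tends to 0.  The trivial partition has modularity 0. *)

(** * Linear inequalities from the growth hypotheses *)

Lemma much_greater_near (R : realType) (f g : nat -> nat) (C : nat) :
  much_greater R f g -> (\forall n \near \oo, (C * g n < f n)%N).
Proof.
move=> /cvgeyPgt /(_ C%:R) h; near=> n.
have : (C%:R%:E < (f n)%:R%:E / (g n)%:R%:E :> \bar R)%E by near: n; exact: h.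
(* If [g n] is zero, the claim is [0 < f n]; it holds because [f n = 0] would make the quotient
   0. *)
have [->|g0] := eqVneq (g n) 0%N.
  rewrite muln0 lt0n; apply: contraTneq => ->.
  by rewrite mul0e lte_fin -leNgt.
rewrite inver pnatr_eq0 (negbTE g0) -EFinM lte_fin.
by rewrite ltr_pdivlMr ?ltr0n ?lt0n// -natrM ltr_nat.
Unshelve. all: by end_near. Qed.

(** * The adjacency operator and Rayleigh quotients *)

Section AdjacencyOperator.
Context {R : realType} {G : sgraph}.
Implicit Types (f g : G -> R) (A : {set G}).

Definition dotp f g : R := \sum_v f v * g v.

Definition adjop f : G -> R := fun v => \sum_(w | adj v w) f w.

Lemma dotpC f g : dotp f g = dotp g f.
Proof. by apply: eq_bigr => v _; rewrite mulrC. Qed.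

Lemma dotp_ge0 f : 0 <= dotp f f.
Proof. by apply: sumr_ge0 => v _; rewrite -expr2 sqr_ge0. Qed.

Lemma dotp_adjop f g : dotp f (adjop g) = dotp (adjop f) g.
Proof.
rewrite /dotp /adjop.
under eq_bigr do rewrite big_distrr/=.
under [RHS]eq_bigr do rewrite big_distrl/=.
rewrite (exchange_big_dep xpredT)//=.
by apply: eq_bigr => v _; apply: eq_bigl => w; rewrite adj_sym.
Qed.

(** Self-adjointness moves [i] of the applications to the left factor; [i = j] turns an even power
    into a squared norm. *)
Lemma dotp_iter_adjop f i j :
  dotp f (iter (i + j) adjop f) = dotp (iter i adjop f) (iter j adjop f).
Proof.
elim: i j => [//|i IH] j.
by rewrite addSnnS IH iterS dotp_adjop.
Qed.

Lemma dotp_cauchy_schwarz f g : 0 < dotp f f ->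
  dotp f g ^+ 2 <= dotp f f * dotp g g.
Proof.
move=> f0; rewrite -subr_ge0 -(pmulr_rge0 _ f0).
have sq a b : \sum_v (a * g v - b * f v) ^+ 2 =
    a ^+ 2 * dotp g g - 2 * a * b * dotp f g + b ^+ 2 * dotp f f.
  rewrite !big_distrr/= -sumrB -big_split/=.
  by apply: eq_bigr => v _; ring.
have -> : dotp f f * (dotp f f * dotp g g - dotp f g ^+ 2) =
    \sum_v (dotp f f * g v - dotp f g * f v) ^+ 2 by rewrite sq; ring.
by apply: sumr_ge0 => v _; exact: sqr_ge0.
Qed.

Lemma dotp_eq0 f : dotp f f = 0 -> f =1 fun=> 0.
Proof.
move=> /psumr_eq0P f0 v; apply/eqP; rewrite -sqrf_eq0 expr2; apply/eqP.
by apply: f0 => // w _; rewrite -expr2 sqr_ge0.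
Qed.

(* By Cauchy-Schwarz [<f, adjop^(2^k) f> / <f, f>] is at least the [2^k]-th
   power of the Rayleigh quotient of [f]. *)
Lemma rayleigh_le (K C : R) f : 0 <= K ->
    (forall k, dotp f (iter k adjop f) <= C * K ^+ k) ->
  dotp f (adjop f) <= K * dotp f f.
Proof.
move=> K0 hC; have [f0|f0] := eqVneq (dotp f f) 0.
  rewrite f0 mulr0 /dotp big1// => v _.
  by rewrite dotp_eq0// mul0r.
have a0 : 0 < dotp f f by rewrite lt_def f0 dotp_ge0.
rewrite leNgt; apply/negP => h.
pose rho := dotp f (adjop f) / dotp f f.
have Krho : K < rho by rewrite /rho ltr_pdivlMr.
have pow k : rho ^+ (2 ^ k) * dotp f f <= dotp f (iter (2 ^ k) adjop f).
  elim: k => [|k IH]; first by rewrite expr1/= divfK.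
  rewrite -(ler_pM2l a0) expnS mul2n -addnn dotp_iter_adjop.
  have := dotp_cauchy_schwarz f (iter (2 ^ k) adjop f) a0.
  apply: le_trans.
  have -> : dotp f f * (rho ^+ (2 ^ k + 2 ^ k) * dotp f f) =
      (rho ^+ (2 ^ k) * dotp f f) ^+ 2 by rewrite exprD; ring.
  have r0 : 0 <= rho ^+ (2 ^ k) * dotp f f.
    by rewrite mulr_ge0 ?dotp_ge0// exprn_ge0// ltW// (le_lt_trans K0).
  by rewrite ler_sqr// nnegrE (le_trans r0).
have rho0 : 0 < rho := le_lt_trans K0 Krho.
have C0 : 0 <= C by have := hC 0%N; rewrite expr0 mulr1 /=; lra.
have q0 : 0 <= K / rho by rewrite divr_ge0// ltW.
have q1 : K / rho < 1 by rewrite ltr_pdivrMr// mul1r.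
(* As [K < rho], the powers of [K / rho] fall below this threshold, which contradicts
   [dotp f f <= C * (K / rho) ^+ (2 ^ k)]. *)
have /cvgr0Pnorm_lt/(_ (dotp f f / (C + 1))) :
    (K / rho) ^+ n @[n --> \oo] --> 0.
  by apply: cvg_expr; rewrite ger0_norm.
case=> [|k _ /(_ k (leqnn k))/=]; first by rewrite divr_gt0// ltr_wpDl.
rewrite ger0_norm ?exprn_ge0// ltr_pdivlMr ?ltr_wpDl// => small.
have : (K / rho) ^+ (2 ^ k) <= (K / rho) ^+ k.
  by rewrite ler_wiXn2l ?(ltW q1)// ltnW// ltn_expl.
have : dotp f f <= C * (K / rho) ^+ (2 ^ k).
  rewrite expr_div_n mulrA ler_pdivlMr ?exprn_gt0// mulrC.
  exact: le_trans (pow k) (hC _).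
have := exprn_ge0 k q0.
nra.
Qed.

End AdjacencyOperator.

(** * Edge counts and the modularity of regular graphs *)

Section Modularity.
Context {R : realType} {G : sgraph}.
Implicit Types (f g : G -> R) (A : {set G}).

(** Sort the ordered pairs of adjacent vertices of [A] by their underlying edge: each edge arises
    from exactly two pairs, as there are no loops. *)
Lemma double_edges_in A :
  (2 * edges_in A = \sum_(v in A) #|[set w in A | adj v w]%SET|)%N.
Proof.
under eq_bigr do rewrite -sum1_card.
rewrite pair_big_dep/=.
rewrite (partition_big (fun p : G * G => [set p.1; p.2]%SET)
  (fun E => (E \in edges G) && (E \subset A)))/=; last first.
  move=> [v w]/=; rewrite inE => /and3P[vA wA vw].
  rewrite finset.subUset !finset.sub1set vA wA/= andbT.
  by apply/imsetP; exists (v, w); rewrite ?inE.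
rewrite /edges_in -sum1_card big_distrr/=.
apply: eq_big => [E|E]; first by rewrite inE.
rewrite inE => /andP[/imsetP[[x y]/= xy ->]].
rewrite finset.subUset !finset.sub1set => /andP[xA yA].
rewrite inE/= in xy.
have nxy : x != y by apply: contraTneq xy => ->; rewrite adj_irr.
rewrite muln1 sum1_card.
transitivity #|[set (x, y); (y, x)]%SET|.
  by rewrite cards2 xpair_eqE (negbTE nxy).
apply: eq_card => -[v w]; rewrite !inE !xpair_eqE/=.
apply/orP/andP => [[/andP[/eqP-> /eqP->]|/andP[/eqP-> /eqP->]]|].
- by rewrite inE xA yA xy eqxx.
- by rewrite inE xA yA adj_sym xy finset.setUC eqxx.
move=> [/andP[_ ]]; rewrite inE => /andP[_ vw] /eqP e.
have nvw : v != w by apply: contraTneq vw => ->; rewrite adj_irr.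
have : v \in [set x; y]%SET by rewrite -e !inE eqxx.
have : w \in [set x; y]%SET by rewrite -e !inE eqxx orbT.
rewrite !inE => /orP[] /eqP wE /orP[] /eqP vE; move: nvw;
  rewrite vE wE ?eqxx // => _; by [left | right].
Qed.

Lemma edges_inT : edges_in [set: G]%SET = #|edges G|.
Proof. by apply: eq_card => E; rewrite inE finset.subsetT andbT. Qed.

Lemma sum_deg : (\sum_(v : G) deg v = 2 * #|edges G|)%N.
Proof.
rewrite -edges_inT double_edges_in; apply: eq_big => v; first by rewrite inE.
by move=> _; apply: eq_card => w; rewrite !inE.
Qed.

Lemma partition_modularity_no_edges (P : {set {set G}}) :
  #|edges G| = 0%N -> partition_modularity R P = 0.
Proof.
move=> m0; rewrite /partition_modularity m0 !big1 ?subrr// => A _.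
  by rewrite expr0n/= mulr0 invr0 mulr0.
by rewrite invr0 mulr0.
Qed.

Lemma modularity_ge0 : 0 <= modularity G R.
Proof.
have [m0|m0] := eqVneq #|edges G| 0%N.
  rewrite /modularity; apply: le_trans (bigmax_ge_id _ _ _ _).
  by rewrite partition_modularity_no_edges.
(* The one-block partition is legitimate only if its block is nonempty, which any edge ensures. *)
have G0 : [set: G]%SET != finset.set0.
  apply: contraNneq m0 => G0; rewrite -(eqn_pmul2l (isT : 0 < 2)%N) muln0.
  rewrite -sum_deg big1// => v _.
  by have := finset.in_setT v; rewrite G0 inE.
have -> : 0 = partition_modularity R [set [set: G]]%SET.
  rewrite /partition_modularity !big_set1 edges_inT.
  rewrite (eq_bigl xpredT) ?sum_deg; last by move=> v; rewrite inE.
  have : #|edges G|%:R != 0 :> R by rewrite pnatr_eq0.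
  by move=> ?; rewrite natrM; field.
rewrite /modularity; apply: le_bigmax_cond.
apply/and3P; split.
- by rewrite finset.cover1.
- apply/finset.trivIsetP => A B /finset.set1P-> /finset.set1P->.
  by rewrite eqxx.
- by rewrite inE eq_sym.
Qed.

(* The hypothesis bounds the second eigenvalue of the adjacency matrix by
   [k * d]. *)
Lemma modularity_le (d : nat) (k : R) :
    0 <= k -> (forall v : G, deg v = d) ->
    (forall f, \sum_v f v = 0 -> dotp f (adjop f) <= k * d%:R * dotp f f) ->
  modularity G R <= k.
Proof.
move=> k0 dG gap.
suff bnd P : finset.partition P [set: G]%SET -> partition_modularity R P <= k.
  by apply: bigmax_le => [|P /bnd//]; apply: bnd; exact: singletons_partition.
have [m0|m0] := eqVneq #|edges G| 0%N.
  by rewrite partition_modularity_no_edges.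
move=> partP; set N : R := #|G|%:R.
have mE : 2 * #|edges G|%:R = N * d%:R :> R.
  by rewrite -!natrM -sum_deg (eq_bigr _ (fun v _ => dG v)) sum_nat_const.
have Nd0 : N * d%:R != 0 by rewrite -mE mulf_neq0 ?pnatr_eq0.
have /andP[N0 d0] : (N != 0) && (d%:R != 0 :> R) by rewrite -negb_or -mulf_eq0.
have Ngt0 : 0 < N by rewrite lt_def N0 ler0n.
have dgt0 : 0 < d%:R :> R by rewrite lt_def d0 ler0n.
have part A :
    2 * (edges_in A)%:R <= d%:R * #|A|%:R ^+ 2 / N + k * d%:R * #|A|%:R.
  (* The gap hypothesis is applied to the indicator of [A] shifted by its mean [c]. *)
  pose c : R := #|A|%:R / N; pose a (v : G) : R := (v \in A)%:R.
  pose f v : R := a v - c.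
  have sA : \sum_v a v = #|A|%:R.
    by rewrite -natr_sum -sum1_card [in RHS]big_mkcond; congr _%:R.
  have f0 : \sum_v f v = 0.
    by rewrite sumrB sA sumr_const -[c *+ _]mulr_natr /c divfK// subrr.
  have fE g : \sum_v g v * f v = \sum_v g v * a v - c * \sum_v g v.
    by rewrite mulrC big_distrl -sumrB; apply: eq_bigr => v _; rewrite mulrBr.
  have := gap _ f0.
  have -> : dotp f f = #|A|%:R - #|A|%:R ^+ 2 / N.
    rewrite /dotp fE f0 mulr0 subr0.
    under eq_bigr do rewrite mulrC.
    rewrite fE sA (eq_bigr a) => [|v _]; last by rewrite /a -natrM mulnb andbb.
    by rewrite sA /c; field.
  have adj1 g : \sum_v adjop g v = d%:R * \sum_v g v.
    rewrite /adjop (exchange_big_dep xpredT)//= big_distrr/=.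
    apply: eq_bigr => v _; rewrite sumr_const -(dG v) /deg -[LHS]mulr_natl.
    congr (_%:R * _); apply: eq_card => w.
    by rewrite !inE unfold_in adj_sym.
  have -> : dotp f (adjop f) = 2 * (edges_in A)%:R - d%:R * #|A|%:R ^+ 2 / N.
    rewrite dotpC /dotp fE adj1 f0 !mulr0 subr0.
    rewrite -[LHS]/(dotp _ a) -dotp_adjop dotpC /dotp fE adj1 sA.
    congr (_ - _); last by rewrite /c; field.
    rewrite -natrM double_edges_in natr_sum [RHS]big_mkcond/=.
    apply: eq_bigr => v _; rewrite /a /adjop.
    case: (v \in A); rewrite ?mulr0 ?mulr1 //.
    rewrite -natr_sum -sum1_card; congr _%:R.
    rewrite [LHS]big_mkcond [RHS]big_mkcond/=.
    by apply: eq_bigr => w _; rewrite inE; case: (w \in A); case: adj.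
  (* [dotp f f] falls short of [#|A|] by [#|A| ^ 2 / N]; this gain is discarded. *)
  have : 0 <= k * d%:R * (#|A|%:R ^+ 2 / N).
    by rewrite !mulr_ge0// invr_ge0 ltW.
  lra.
rewrite /partition_modularity -sumrB.
(* Splitting [k] among the blocks in proportion to their sizes lets the bound be checked block by
   block. *)
have -> : k = \sum_(A in P) k * #|A|%:R / N.
  rewrite -mulr_suml -mulr_sumr -natr_sum -(finset.card_partition partP).
  by rewrite cardsT mulfK.
apply: ler_sum => A _.
rewrite (eq_bigr _ (fun v _ => dG v)) sum_nat_const natrM.
have -> : 4 * #|edges G|%:R ^+ 2 = (N * d%:R) ^+ 2 :> R by rewrite -mE; ring.
have -> : #|edges G|%:R = N * d%:R / 2 :> R by rewrite -mE; field.
have := part A; set a : R := #|A|%:R; set e : R := (edges_in A)%:R => h.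
have -> : e / (N * d%:R / 2) - (a * d%:R) ^+ 2 / (N * d%:R) ^+ 2 =
    (2 * e - d%:R * a ^+ 2 / N) / (N * d%:R) by field; rewrite N0 d0.
rewrite ler_pdivrMr ?mulr_gt0//.
have -> : k * a / N * (N * d%:R) = k * d%:R * a by field.
lra.
Qed.

End Modularity.

(* The probability that a random neighbour of [v] contains [a], for [a] in [v],
   plus the probability that it contains [b], for [b] outside [v]. *)
Definition contraction_rate (R : realType) (n r s : nat) : R :=
  s%:R / r%:R + (r - s)%:R / (n - r)%:R.

Lemma contraction_rate_ge0 (R : realType) (n r s : nat) :
  0 <= contraction_rate R n r s.
Proof. by rewrite addr_ge0// divr_ge0. Qed.

(** * Coordinate swaps and neighbour counts in the Johnson graph *)

Section Johnson.
Context {n r s : nat}.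
Notation J := (johnson n r s).
Implicit Types (v w : J) (a b c : 'I_n).

Fact swap_subproof a b v :
  (\sum_(i < n) [ffun j => val v (tperm a b j)] i == r)%N.
Proof.
rewrite -[X in _ == X](eqP (valP v)).
rewrite [X in _ == X](reindex_inj (@perm_inj _ (tperm a b)))/=.
by apply/eqP; apply: eq_bigr => i _; rewrite ffunE.
Qed.

Definition swap a b v : J :=
  exist (fun u : {ffun 'I_n -> bool} => \sum_(i < n) u i == r)%N _
    (swap_subproof a b v).

Lemma swapE a b v c : val (swap a b v) c = val v (tperm a b c).
Proof. by rewrite SubK ffunE. Qed.

Lemma swapK a b : involutive (swap a b).
Proof. by move=> v; apply/val_inj/ffunP => c; rewrite !swapE tpermK. Qed.

Lemma swap_id a b v : val v a = val v b -> swap a b v = v.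
Proof.
move=> vab; apply/val_inj/ffunP => c; rewrite swapE.
by case: tpermP => [->|->|].
Qed.

(** Permuting the coordinates of both vectors preserves their inner product, so a swap is a graph
    automorphism. *)
Lemma adj_swap a b v w : adj (swap a b v) (swap a b w) = adj v w.
Proof.
rewrite /= /johnson_adj (inj_eq (inv_inj (swapK a b))); congr (_ && (_ == _)).
rewrite /inner [RHS](reindex_inj (@perm_inj _ (tperm a b)))/=.
by apply: eq_bigr => i _; rewrite !ffunE.
Qed.

Definition nbrs_through v a := #|[set w | adj v w & val w a]%SET|.

Lemma nbrs_through_swap a b c v :
  nbrs_through (swap a b v) c = nbrs_through v (tperm a b c).
Proof.
rewrite /nbrs_through -(card_imset _ (inv_inj (swapK a b))).
apply: eq_card => w; rewrite !inE -(swapK a b w) mem_imset ?inE;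
  last exact: inv_inj (swapK a b).
by rewrite -{1}(swapK a b v) adj_swap swapK -swapE swapK.
Qed.

(** The swap fixes [v] and exchanges its neighbours through [a] with those through [b]. *)
Lemma nbrs_through_same a b v :
  val v a = val v b -> nbrs_through v a = nbrs_through v b.
Proof. by move=> /swap_id vE; rewrite -{1}vE nbrs_through_swap tpermL. Qed.

Lemma card_ones v : #|[pred i | val v i]| = r.
Proof.
rewrite -[RHS](eqP (valP v)) -sum1_card big_mkcond/=.
by apply: eq_bigr => i _; rewrite inE; case: (val v i).
Qed.

Lemma card_zeros v : #|[pred i | ~~ val v i]| = (n - r)%N.
Proof.
have := cardC [pred i | val v i]; rewrite card_ord card_ones.
by move=> /(congr1 (subn^~ r)); rewrite addKn => <-; apply: eq_card.
Qed.

Lemma sum_nbrs_through (P : pred 'I_n) v :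
  (\sum_(a | P a) nbrs_through v a =
   \sum_(w | adj v w) #|[pred a | P a & val w a]|)%N.
Proof.
rewrite /nbrs_through; under eq_bigr do rewrite -sum1_card.
rewrite (exchange_big_dep (adj v))/=; last first.
  by move=> a w _; rewrite inE => /andP[].
apply: eq_bigr => w vw; rewrite -sum1_card; apply: eq_bigl => a.
by rewrite !inE vw.
Qed.

(** Count pairs of a one of [v] and a neighbour through it: all [r] ones lie on equally many
    neighbours, and each neighbour meets [v] in [s] places. *)
Lemma nbrs_through_one a v :
  val v a -> (r * nbrs_through v a = s * deg v)%N.
Proof.
move=> va; rewrite -{1}(card_ones v) -sum_nat_const.
transitivity (\sum_(c | val v c) nbrs_through v c)%N.
  apply: eq_bigr => c vc; apply: nbrs_through_same.
  by rewrite va (vc : val v c).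
rewrite sum_nbrs_through mulnC /deg -sum_nat_const; apply: eq_big => [w|w].
  by rewrite inE.
case/andP=> _ /eqP <-; rewrite -sum1_card big_mkcond/=.
by apply: eq_bigr => i _; rewrite inE mulnb; case: (_ && _).
Qed.

(** The same count over the zeros of [v], where each neighbour has its remaining [r - s] ones. *)
Lemma nbrs_through_zero a v :
  ~~ val v a -> ((n - r) * nbrs_through v a = (r - s) * deg v)%N.
Proof.
move=> va; rewrite -{1}(card_zeros v) -sum_nat_const.
transitivity (\sum_(c | ~~ val v c) nbrs_through v c)%N.
  apply: eq_bigr => c vc; apply: nbrs_through_same.
  by rewrite (negbTE va) (negbTE (vc : ~~ val v c)).
rewrite sum_nbrs_through mulnC /deg -sum_nat_const; apply: eq_big => [w|w].
  by rewrite inE.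
case/andP=> _ /eqP <-.
have := cardID [pred i | val v i] [pred i | val w i].
rewrite card_ones [X in (X + _)%N](_ : _ = inner (val v) (val w)); last first.
  rewrite -sum1_card big_mkcond/=.
  by apply: eq_bigr => i _; rewrite !inE mulnb andbC; case: (_ && _).
move=> /(congr1 (subn^~ (inner (val v) (val w)))); rewrite addKn => <-.
by apply: eq_card => i; rewrite !inE.
Qed.

(** Both supports have [r] elements, so neither of two distinct ones contains the other. *)
Lemma vertex_disagree v w : v != w ->
  exists a b, [/\ val v a, ~~ val w a, ~~ val v b & val w b].
Proof.
move=> nvw; have nle (x y : J) : x != y -> exists a, val x a && ~~ val y a.
  move=> nxy; apply/existsP; apply: contraNT nxy.
  rewrite negb_exists => /forallP xy; apply/eqP/val_inj/ffunP.
  have /subset_cardP sub : #|[pred i | val x i]| = #|[pred i | val y i]|.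
    by rewrite !card_ones.
  suff /sub xy_eq : [pred i | val x i] \subset [pred i | val y i].
    by move=> i; have := xy_eq i; rewrite !inE.
  apply/fintype.subsetP => i; rewrite !inE => xi.
  by have := xy i; rewrite xi/= => /negPn.
have [a /andP[? ?]] := nle _ _ nvw.
have [|b /andP[? ?]] := nle w v; first by rewrite eq_sym.
by exists a, b.
Qed.

(** * Contraction of Lipschitz functions and the spectral gap *)

Section Lipschitz.
Context {R : realType}.
Implicit Types (f : J -> R) (L : R).

Definition swap_lipschitz L f := forall a b v, `|f (swap a b v) - f v| <= L.

(** Walk from [v] to [w] by swaps, each moving a one of [v] that [w] lacks to a place where only [w]
    has a one. Every swap lowers the number of disagreements, so at most [n] are needed. *)
Lemma swap_lipschitz_dist L f v w : 0 <= L -> swap_lipschitz L f ->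
  `|f v - f w| <= L * n%:R.
Proof.
move=> L0 fL.
suff dist m : forall v, (#|[pred i | val v i != val w i]| <= m)%N ->
    `|f v - f w| <= L * m%:R.
  by apply: dist; rewrite -[leqRHS]card_ord max_card.
elim: m => {v}[|m IH] v.
  rewrite leqn0 => /eqP/card0_eq v0.
  suff -> : v = w by rewrite subrr normr0 mulr0.
  apply/val_inj/ffunP => i; apply/eqP.
  by have := v0 i; rewrite inE => /negbFE.
move=> vm; have [->|/vertex_disagree[a [b [va wa vb wb]]]] := eqVneq v w.
  by rewrite subrr normr0 mulr_ge0.
have := fL a b v; rewrite distrC => h1.
have /IH h2 : (#|[pred i | val (swap a b v) i != val w i]| <= m)%N.
  rewrite -ltnS; apply: leq_trans vm; apply: proper_card.
  apply/properP; split; last first.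
    by exists a; rewrite !inE ?swapE ?tpermL ?va ?(negbTE vb) (negbTE wa).
  apply/fintype.subsetP => i; rewrite !inE swapE.
  by case: tpermP => [->|->|//]; rewrite ?va ?(negbTE vb) ?wb ?(negbTE wa).
rewrite -natr1 mulrDr mulr1 [leRHS]addrC.
apply: le_trans (lerD h1 h2).
exact: ler_distD.
Qed.

Lemma deg_swap a b v : deg (swap a b v) = deg v.
Proof.
rewrite /deg -(card_imset _ (inv_inj (swapK a b))).
apply: eq_card => w; rewrite -(swapK a b w) mem_imset;
  last exact: inv_inj (swapK a b).
by rewrite !inE swapK adj_swap.
Qed.

(** The degree is invariant under swaps, hence Lipschitz with constant 0, hence constant. *)
Lemma johnson_regular v w : deg v = deg w.
Proof.
have /(swap_lipschitz_dist _ (fun v => (deg v)%:R) v w (lexx 0)) :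
    swap_lipschitz 0 (fun v => (deg v)%:R).
  by move=> a b x; rewrite deg_swap subrr normr0.
by rewrite mul0r normr_le0 subr_eq0 eqr_nat => /eqP.
Qed.

Notation rate := (contraction_rate R n r s).

Lemma swap_lipschitz_adjop L f d : (0 < r < n)%N -> 0 <= L ->
    (forall v : J, deg v = d) -> swap_lipschitz L f ->
  swap_lipschitz (rate * d%:R * L) (adjop f).
Proof.
move=> /andP[r0 rn] L0 dJ fL.
have r0' : r%:R != 0 :> R by rewrite pnatr_eq0 -lt0n.
have nr0' : (n - r)%:R != 0 :> R by rewrite pnatr_eq0 -lt0n subn_gt0.
have G0 : 0 <= rate * d%:R * L by rewrite !mulr_ge0// contraction_rate_ge0.
have linkE a b v : val v a -> ~~ val v b ->
    (nbrs_through v a)%:R + (nbrs_through v b)%:R = rate * d%:R.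
  move=> va vb; rewrite /contraction_rate mulrDl; congr (_ + _).
    rewrite mulrAC -natrM -(dJ v) -(nbrs_through_one a)// natrM mulrAC divff//.
    by rewrite mul1r.
  rewrite mulrAC -natrM -(dJ v) -(nbrs_through_zero b)// natrM mulrAC divff//.
  by rewrite mul1r.
move=> a b v; have [vab|vab] := eqVneq (val v a) (val v b).
  by rewrite swap_id// subrr normr0.
have -> : rate * d%:R = (nbrs_through v a)%:R + (nbrs_through v b)%:R.
  case: (boolP (val v a)) vab => va; case: (boolP (val v b)) => vb// _.
    by rewrite linkE.
  by rewrite addrC linkE.
(* The coupling: [swap a b] carries the neighbours of [v] to those of [swap a b v]. *)
have -> : adjop f (swap a b v) = \sum_(w | adj v w) f (swap a b w).
  rewrite /adjop (reindex_inj (inv_inj (swapK a b))).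
  by apply: eq_bigl => w; rewrite adj_swap.
rewrite /adjop -sumrB; apply: le_trans (ler_norm_sum _ _ _) _.
have -> : ((nbrs_through v a)%:R + (nbrs_through v b)%:R) * L =
    \sum_(w | adj v w) ((val w a)%:R + (val w b)%:R) * L.
  rewrite -mulr_suml big_split/= -!natr_sum; congr ((_%:R + _%:R) * _);
    rewrite /nbrs_through -sum1_card big_mkcond [RHS]big_mkcond/=;
    apply: eq_bigr => w _; rewrite inE;
    by case: johnson_adj => //=; case: (val w _).
apply: ler_sum => w _.
(* The swap fixes [w] if its values at [a] and [b] agree; otherwise exactly one of them is a one and
   [L] has weight 1. *)
have [wab|wab] := eqVneq (val w a) (val w b).
  by rewrite swap_id// subrr normr0 mulr_ge0.
apply: le_trans (fL a b w) _; rewrite -[leLHS]mul1r ler_wpM2r//.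
by case: (val w a) (val w b) wab => -[]//; rewrite ?addr0 ?add0r.
Qed.

Lemma johnson_spectral_gap f d : (0 < r < n)%N ->
    (forall v : J, deg v = d) -> \sum_v f v = 0 ->
  dotp f (adjop f) <= rate * d%:R * dotp f f.
Proof.
move=> rn dJ f0.
(* This norm bounds every value of [f], so [2 * M] is a Lipschitz constant; it also bounds the total
   weight in the inner product below. *)
pose M : R := \sum_v `|f v|.
have M0 : 0 <= M by apply: sumr_ge0.
have fM v : `|f v| <= M.
  by rewrite /M (bigD1 v)//= lerDl sumr_ge0.
have K0 : 0 <= rate * d%:R by rewrite mulr_ge0 ?contraction_rate_ge0.
have lip k :
    swap_lipschitz ((rate * d%:R) ^+ k * (2 * M)) (iter k (@adjop R J) f).
  elim: k => [|k IH].
    move=> a b v; rewrite expr0 mul1r mulrDl mul1r.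
    by apply: le_trans (ler_normB _ _) _; rewrite lerD.
  rewrite iterS exprS -mulrA; apply: swap_lipschitz_adjop => //.
  by rewrite mulr_ge0 ?exprn_ge0// mulr_ge0.
apply: (rayleigh_le _ (M * (2 * M * n%:R))) => // k.
have [v0 _|J0] := pickP (fun _ : J => true); last first.
  rewrite /dotp big1 ?mulr_ge0// ?exprn_ge0// => v.
  by have := J0 v.
(* Mean zero permits subtracting the value at [v0], leaving only differences, which the Lipschitz
   constant times [n] controls. *)
have -> : dotp f (iter k adjop f) =
    \sum_v f v * (iter k adjop f v - iter k adjop f v0).
  under [RHS]eq_bigr do rewrite mulrBr.
  by rewrite sumrB -mulr_suml f0 mul0r subr0.
rewrite /M !mulr_suml; apply: ler_sum => v _; apply: le_trans (ler_norm _) _.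
rewrite normrM -!mulrA ler_wpM2l//.
apply: le_trans (swap_lipschitz_dist _ _ v v0 _ (lip k)) _.
  by rewrite mulr_ge0 ?exprn_ge0// mulr_ge0.
by rewrite le_eqVlt -/M; apply/orP; left; apply/eqP; ring.
Qed.

Lemma johnson_modularity_le : (0 < r < n)%N -> modularity J R <= rate.
Proof.
move=> rn; have [d dJ] : exists d, forall v : J, deg v = d.
  have [v0 _|J0] := pickP (fun _ : J => true).
    by exists (deg v0) => v; exact: johnson_regular.
  by exists 0%N => v; have := J0 v.
apply: (modularity_le _ _ (contraction_rate_ge0 _ _ _ _) dJ) => f f0.
exact: johnson_spectral_gap rn dJ f0.
Qed.

End Lipschitz.
End Johnson.

(** * Passage to the limit *)

Theorem corollary3p1p5 (R : realType) (r s : nat -> nat)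
    (n_gg_r : much_greater R (fun n => n) r)
    (r_gg_s : much_greater R r s) :
  modularity (johnson n (r n) (s n)) R @[n --> \oo] --> (0 : R).
Proof.
apply/cvgr0Pnorm_lt => e e0.
(* Each of the two summands of the rate will be at most [1 / (C + 1)], which is below [e / 2]. *)
pose C := Num.truncn (2 / e).
have C0 : 2 / e < C.+1%:R by exact: truncnS_gt.
near=> n.
(* The factor is [C + 2] because the denominator [n - r n] uses up one copy of [r n]. *)
have hr : (C.+2 * r n < n)%N.
  by near: n; exact: much_greater_near n_gg_r.
have hs : (C.+2 * s n < r n)%N.
  by near: n; exact: much_greater_near r_gg_s.
have r0 : (0 < r n)%N by exact: leq_ltn_trans hs.
have rn : (r n < n)%N by apply: leq_ltn_trans hr; exact: leq_pmull.
rewrite ger0_norm ?modularity_ge0//.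
apply: le_lt_trans (johnson_modularity_le _) _; first by rewrite r0.
have c0 : 0 < C.+1%:R :> R by [].
have le1 : (s n)%:R / (r n)%:R <= C.+1%:R^-1 :> R.
  rewrite ler_pdivrMr ?ltr0n// ler_pdivlMl// -natrM ler_nat ltnW//.
  by apply: leq_ltn_trans hs; rewrite leq_mul2r leqnSn orbT.
have le2 : (r n - s n)%:R / (n - r n)%:R <= C.+1%:R^-1 :> R.
  rewrite ler_pdivrMr ?ltr0n ?subn_gt0// ler_pdivlMl// -natrM ler_nat.
  rewrite leq_subRL; last exact: ltnW.
  apply: leq_trans (ltnW hr); rewrite [leqRHS]mulSn leq_add2l.
  by rewrite leq_mul2l leq_subr orbT.
apply: le_lt_trans (lerD le1 le2) _.
rewrite -mulr2n -[ltLHS]mulr_natl ltr_pdivrMr// mulrC.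
by rewrite -ltr_pdivrMr.
Unshelve. all: by end_near. Qed.
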